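(* There is a universal constant $C>0$ such that the following holds. Let $\mathcal{D}$ be a probability distribution over a domain $X$, let $n\ge 1$, let $f:X^n\to\mathbb{R}$, and let $\Delta,\lambda>0$ be such that for every $1\le i\le n$ $$\mathbb{E}_{S\sim\mathcal{D}^n,\; z\sim\mathcal{D}}\Big[\mathbf{1}\big\{|f(S)-f(S^{(i\leftarrow z)})|>\lambda\big\}\cdot\big|f(S)-f(S^{(i\leftarrow z)})\big|\Big]\le\Delta. \qquad ( * )$$ (Part 1) For every $\varepsilon>0$, if $n\ge C\cdot\frac{1}{\varepsilon\cdot\min\{1,\varepsilon\}}\log\left(\frac{\lambda\cdot\min\{1,\varepsilon\}}{\Delta}\right)$, then $$\Pr_{S\sim\mathcal{D}^n}\big[|f(S)-f(\mathcal{D}^n)|\ge 18\varepsilon\lambda n\big]<\frac{14\Delta}{\varepsilon\lambda}.$$ (Part 2) Suppose that, in addition to $( * )$, there is $0<\tau\le\lambda$ such that for every $S\in X^n$ and every $1\le i\le n$ $$\mathbb{E}_{y,z\sim\mathcal{D}}\Big[\mathbf{1}\big\{|f(S^{(i\leftarrow y)})-f(S^{(i\leftarrow z)})|\le\lambda\big\}\cdot\big|f(S^{(i\leftarrow y)})-f(S^{(i\leftarrow z)})\big|\Big]\le\tau.$$ Then for every $\varepsilon>0$, if $n\ge C\cdot\frac{\lambda}{\varepsilon\cdot\min\{1,\varepsilon\}\,\tau}\log\left(\frac{\tau\cdot\min\{1,\varepsilon\}}{\Delta}\right)$, then $$\Pr_{S\sim\mathcal{D}^n}\big[|f(S)-f(\mathcal{D}^n)|\ge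 18\varepsilon\tau n\big]<\frac{14\Delta}{\varepsilon\tau}.$$
   Context: $S\sim\mathcal{D}^n$ means $S=(x_1,\dots,x_n)$ has i.i.d. entries drawn from $\mathcal{D}$; in the expectations all of $S,y,z$ are drawn independently. $S^{(i\leftarrow z)}$ denotes $S$ with its $i$-th element replaced by $z$. $f(\mathcal{D}^n):=\mathbb{E}_{S\sim\mathcal{D}^n}[f(S)]$; $f$ is assumed measurable with this expectation well defined and finite. $\mathbf{1}\{\cdot\}$ is the indicator function. *)

(* Defs.v *)
From HB Require Import structures.
From mathcomp Require Import all_boot all_order all_algebra.
From mathcomp Require Import all_classical all_reals all_analysis.

Set Implicit Arguments.
Unset Strict Implicit.
Unset Printing Implicit Defensive.

Import Order.TTheory GRing.Theory Num.Theory.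

Local Open Scope classical_set_scope.
Local Open Scope ring_scope.

Section prob_power.
Context d (X : measurableType d) (R : realType).

Definition cons_pair n (p : X * n.-tuple X) : n.+1.-tuple X :=
  [tuple of p.1 :: p.2].

Lemma measurable_cons_pair n : measurable_fun setT (@cons_pair n).
Proof. exact: (measurable_cons measurable_fst measurable_snd). Qed.

HB.instance Definition _ n :=
  isMeasurableFun.Build _ _ _ _ (@cons_pair n) (@measurable_cons_pair n).

(* The n-fold product D^n on the product sigma-algebra of X^n = n.-tuple X: the
   law of (x_1, ..., x_n) with i.i.d. entries drawn from D. See prob_power_box. *)
Fixpoint prob_power (D : probability X R) n : probability (n.-tuple X) R :=
  match n with
  | 0 => @dirac _ (0.-tuple X) [tuple] R
  | m.+1 => distribution (D \x prob_power D m)%E (@cons_pair m)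
  end.

Lemma prob_power_box (D : probability X R) n (A : 'I_n -> set X) :
  (forall i, measurable (A i)) ->
  prob_power D n [set S | forall i, A i (tnth S i)] = (\prod_(i < n) D (A i))%E.
Proof.
elim: n A => [|n IHn] A mA.
  rewrite big_ord0 /= diracE mem_set//= => -[].
  by [].
rewrite big_ord_recl -IHn; last by move=> i; exact: mA.
have mB : measurable [set S : n.-tuple X | forall i, A (lift ord0 i) (tnth S i)].
  rewrite [X in measurable X](_ : _ =
      \bigcap_(i in [set: 'I_n]) ((@tnth n X)^~ i @^-1` A (lift ord0 i))).
    apply: fin_bigcap_measurable => // i _.
    by rewrite -[X in measurable X]setTI; exact: measurable_tnth.
  by apply/seteqP; split => [S AS i _|S AS i]; [exact: AS|exact: (AS i)].
rewrite -product_measure1E//= /distribution /pushforward/=.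
congr product_measure1; apply/seteqP; split => -[x S] /= AS.
  split; first by have := AS ord0.
  by move=> i; have := AS (lift ord0 i); rewrite /cons_pair tnthS.
move=> i; case: (unliftP ord0 i) => [j|] ->.
  by rewrite /cons_pair tnthS; apply: AS.2.
by case: AS.
Qed.

End prob_power.

(* S^(i <- z) *)
Definition tuple_replace (T : Type) n (S : n.-tuple T) (i : 'I_n) (z : T) :
    n.-tuple T :=
  [tuple if j == i then z else tnth S j | j < n].

(* Main.v *)
(* With f(S) - E f written as the sum of its Doob martingale differences
   E[f(S) - f(S^(i<-z)) | x_i, ..., x_n], cut f(S) - f(S^(i<-z)) at lambda.  The
   large parts contribute at most n Delta in L1, which Markov's inequality
   handles.  The small parts are antisymmetric in (x_i, z), hence still average
   to martingale differences; these are bounded by lambda and have conditional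
   L1 norm at most tau, so a Bennett-type exponential bound applies.  C = 1 is
   enough: the Chernoff parameter is eps / lambda for eps <= 1 and
   (1 + ln eps) / lambda for eps > 1, where the Poissonian tail supplies the
   factor 1 / eps; when tau < e Delta the first moment alone suffices.  Part 1 is
   the case tau = lambda of Part 2.  Clipping f beforehand, at an L1 cost of at
   most n Delta, makes every conditional expectation an everywhere defined
   bounded function. *)
Require Import Defs.
From mathcomp Require Import all_boot all_order all_algebra.
From mathcomp Require Import all_classical all_reals all_analysis.
From mathcomp Require Import measurable_realfun ring lra.

Import Order.TTheory GRing.Theory Num.Theory.

Local Open Scope classical_set_scope.
Local Open Scope ring_scope.

Set Implicit Arguments.
Unset Strict Implicit.

(** * Bounded measurable functions *)

Section bounded_measurable.
Context {R : realType}.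

(** The bound holds at every point, not almost everywhere, so all sections of a function of several
    variables are integrable and its partial integrals stay in the class. *)
Definition bmeas {d} {T : measurableType d} (f : T -> R) :=
  measurable_fun [set: T] f /\ exists K, forall x, `|f x| <= K.

Context {d d'} {T : measurableType d} {U : measurableType d'}.
Implicit Types f g : T -> R.

Lemma bmeas_integrable (P : probability T R) f :
  bmeas f -> P.-integrable setT (EFin \o f).
Proof.
move=> [mf [K fK]]; apply: measurable_bounded_integrable => //.
  by rewrite (le_lt_trans (probability_le1 P _)) ?ltry.
exists K; split; first exact: num_real.
by move=> M KM x _ /=; exact: le_trans (fK x) (ltW KM).
Qed.

Lemma bmeas_comp (f : T -> R) (h : U -> T) :
  bmeas f -> measurable_fun [set: U] h -> bmeas (fun x => f (h x)).
Proof.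
move=> [mf [K fK]] mh; split; first exact: measurableT_comp.
by exists K => x; exact: fK.
Qed.

Lemma bmeas_cst (c : R) : bmeas (fun _ : T => c).
Proof. by split; [exact: measurable_cst|exists `|c|]. Qed.

Lemma bmeasD f g : bmeas f -> bmeas g -> bmeas (fun x => f x + g x).
Proof.
move=> [mf [K fK]] [mg [L gL]]; split; first exact: measurable_funD.
by exists (K + L) => x; rewrite (le_trans (ler_normD _ _)) // lerD.
Qed.

Lemma bmeasN f : bmeas f -> bmeas (fun x => - f x).
Proof.
move=> [mf [K fK]]; split; first exact: measurableT_comp.
by exists K => x; rewrite normrN.
Qed.

Lemma bmeasB f g : bmeas f -> bmeas g -> bmeas (fun x => f x - g x).
Proof. by move=> bf bg; apply: bmeasD => //; exact: bmeasN. Qed.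

Lemma bmeasM f g : bmeas f -> bmeas g -> bmeas (fun x => f x * g x).
Proof.
move=> [mf [K fK]] [mg [L gL]]; split; first exact: measurable_funM.
by exists (K * L) => x; rewrite normrM ler_pM.
Qed.

Lemma bmeas_norm f : bmeas f -> bmeas (fun x => `|f x|).
Proof.
move=> [mf [K fK]]; split; first exact: measurableT_comp.
by exists K => x; rewrite normr_id.
Qed.

Lemma bmeas_expR f : bmeas f -> bmeas (fun x => expR (f x)).
Proof.
move=> [mf [K fK]]; split; first exact: measurableT_comp.
exists (expR K) => x; rewrite ger0_norm ?expR_ge0 // ler_expR.
exact: le_trans (ler_norm _) (fK x).
Qed.

End bounded_measurable.

(** * Real-valued integrals of bounded measurable functions *)

Section bounded_integral.
Context {R : realType} {d} {T : measurableType d} (P : probability T R).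
Implicit Types f g : T -> R.

Lemma bint_EFin f : bmeas f ->
  (\int[P]_x f x)%:E = (\int[P]_x (f x)%:E)%E.
Proof.
move=> bf; rewrite /Rintegral fineK //.
exact/integrable_fin_num/bmeas_integrable.
Qed.

Lemma bintD f g : bmeas f -> bmeas g ->
  \int[P]_x (f x + g x) = \int[P]_x f x + \int[P]_x g x.
Proof. by move=> bf bg; rewrite RintegralD//; exact: bmeas_integrable. Qed.

Lemma bintB f g : bmeas f -> bmeas g ->
  \int[P]_x (f x - g x) = \int[P]_x f x - \int[P]_x g x.
Proof. by move=> bf bg; rewrite RintegralB//; exact: bmeas_integrable. Qed.

Lemma bintN f : bmeas f -> \int[P]_x (- f x) = - \int[P]_x f x.
Proof.
move=> bf; under eq_Rintegral do rewrite -mulN1r.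
by rewrite RintegralZl// ?mulN1r//; exact: bmeas_integrable.
Qed.

Lemma bintZ (c : R) f : bmeas f -> \int[P]_x (c * f x) = c * \int[P]_x f x.
Proof. by move=> bf; rewrite RintegralZl//; exact: bmeas_integrable. Qed.

Lemma bint_cst (c : R) : \int[P]_x c = c.
Proof. by rewrite Rintegral_cst//= probability_setT mulr1. Qed.

Lemma le_bint f g : bmeas f -> bmeas g -> (forall x, f x <= g x) ->
  \int[P]_x f x <= \int[P]_x g x.
Proof. by move=> bf bg fg; apply: le_Rintegral => //; exact: bmeas_integrable. Qed.

Lemma bint_le_cst f (c : R) : bmeas f -> (forall x, f x <= c) ->
  \int[P]_x f x <= c.
Proof. 
move=> bf fc; rewrite -[leRHS]bint_cst; apply: le_bint => //.
exact: bmeas_cst.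
Qed.

Lemma le_norm_bint f : bmeas f -> `|\int[P]_x f x| <= \int[P]_x `|f x|.
Proof. by move=> bf; apply: le_normr_Rintegral => //; exact: bmeas_integrable. Qed.

Lemma norm_bint_le f K : bmeas f -> (forall x, `|f x| <= K) ->
  `|\int[P]_x f x| <= K.
Proof.
move=> bf fK; apply: le_trans (le_norm_bint _) _ => //.
by apply: bint_le_cst => //; exact: bmeas_norm.
Qed.

End bounded_integral.

(** * Partial integration and Fubini's theorem *)

Lemma bmeas_bint {R : realType} {d d'} {T : measurableType d}
    {U : measurableType d'} (Q : probability U R) (F : T * U -> R) :
  bmeas F -> bmeas (fun x => \int[Q]_y F (x, y)).
Proof.
move=> bF; case: (bF) => mF [K FK].
have bFx x : bmeas (fun y => F (x, y)).
  by apply: (bmeas_comp bF); exact: measurable_pair1.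
split; last by exists K => x; exact: norm_bint_le.
(* Adding the bound [K] makes the integrand nonnegative, so that Tonelli's measurability statement
   applies; [K] is subtracted afterwards. *)
rewrite [X in measurable_fun _ X](_ : _ =
    fun x => fine (fubini_F Q (fun p => (F p + K)%:E) x) - K); last first.
  apply/funext => x; rewrite -[fine _]/(\int[Q]_y (F (x, y) + K)).
  by rewrite bintD ?bint_cst ?addrK//; exact: bmeas_cst.
apply: measurable_funB => //; apply: measurableT_comp => //.
apply: measurable_fun_fubini_tonelli_F.
  by apply/measurable_EFinP; exact: measurable_funD.
by move=> p; rewrite lee_fin -lerBlDr sub0r; have /ler_normlP[] := FK p; rewrite lerNl.
Qed.

Section bounded_fubini.
Context {R : realType} {d d'} {T : measurableType d} {U : measurableType d'}.
Variables (P : probability T R) (Q : probability U R).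

Lemma bint_prod (F : T * U -> R) : bmeas F ->
  \int[(P \x Q)%E]_p F p = \int[Q]_y \int[P]_x F (x, y).
Proof.
move=> bF; apply: EFin_inj.
have bF' : bmeas (fun p : U * T => F (p.2, p.1)).
  by apply: (bmeas_comp bF); exact: measurable_swap.
apply: etrans (bint_EFin _ bF) _.
apply: etrans (esym (integral21_prod_meas1 (bmeas_integrable (P \x Q)%E bF))) _.
apply: etrans (esym (bint_EFin _ (bmeas_bint P bF'))).
apply: eq_integral => y _; apply/esym/bint_EFin.
by apply: (bmeas_comp bF); exact: measurable_pair2.
Qed.

Lemma bint_swap (F : T * U -> R) : bmeas F ->
  \int[P]_x \int[Q]_y F (x, y) = \int[Q]_y \int[P]_x F (x, y).
Proof.
move=> bF; rewrite -bint_prod//; apply: EFin_inj.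
apply: etrans (bint_EFin _ (bmeas_bint Q bF)) _.
apply: etrans (esym (bint_EFin (P \x Q)%E bF)).
apply: etrans (integral12_prod_meas1 (bmeas_integrable (P \x Q)%E bF)).
apply: eq_integral => x _; apply: bint_EFin.
by apply: (bmeas_comp bF); exact: measurable_pair1.
Qed.

End bounded_fubini.

(** * Replacing one coordinate, and integration over the product law *)

Section replace.
Context {d} {X : measurableType d} {R : realType} (D : probability X R).

Lemma measurable_tuple_replace n (i : 'I_n) :
  measurable_fun setT (fun p : n.-tuple X * X => tuple_replace p.1 i p.2).
Proof.
apply/measurable_fun_tnthP => j.
rewrite [X in measurable_fun _ X](_ : _ =
    fun p => if j == i then p.2 else tnth p.1 j); last first.
  by apply/funext => p /=; rewrite tnth_mktuple.
case: eqP => _; first exact: measurable_snd.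
exact: (measurableT_comp (measurable_tnth j) measurable_fst).
Qed.

Lemma tuple_replace0 n (x z : X) (S : n.-tuple X) :
  tuple_replace (cons_pair (x, S)) ord0 z = cons_pair (z, S).
Proof.
apply: eq_from_tnth => j; rewrite tnth_mktuple /cons_pair.
case: (unliftP ord0 j) => [k ->|->] /=.
  by rewrite !tnthS.
by rewrite tnth0.

Qed.

Lemma tuple_replaceS n (x z : X) (S : n.-tuple X) (i : 'I_n) :
  tuple_replace (cons_pair (x, S)) (lift ord0 i) z
  = cons_pair (x, tuple_replace S i z).
Proof.
apply: eq_from_tnth => j; rewrite tnth_mktuple /cons_pair.
case: (unliftP ord0 j) => [k ->|->]; last by rewrite eq_liftF !tnth0.
by rewrite !tnthS tnth_mktuple (inj_eq lift_inj).
Qed.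

Lemma tuple_replaceK n (S : n.-tuple X) i y z :
  tuple_replace (tuple_replace S i y) i z = tuple_replace S i z.
Proof.
by apply: eq_from_tnth => j; rewrite !tnth_mktuple; case: eqP.
Qed.

Lemma tuple_replace_tnth n (S : n.-tuple X) i :
  tuple_replace S i (tnth S i) = S.
Proof.
by apply: eq_from_tnth => j; rewrite !tnth_mktuple; case: eqP => [->|].
Qed.

Lemma measurable_tuple_replace_at n (S : n.-tuple X) i :
  measurable_fun setT (fun z => tuple_replace S i z).
Proof.
exact: measurableT_comp (measurable_tuple_replace i) (measurable_pair1 S).
Qed.

(** Peels off the first coordinate as the innermost integral; this drives the induction on the
    number of coordinates. *)
Lemma bint_prob_power n (F : n.+1.-tuple X -> R) : bmeas F ->
  \int[prob_power D n.+1]_S F S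
  = \int[prob_power D n]_S \int[D]_x F (cons_pair (x, S)).
Proof.
move=> bF.
have bFc : bmeas (F \o @cons_pair _ X n).
  by apply: (bmeas_comp bF); exact: measurable_cons_pair.
rewrite -(@bint_prod _ _ _ _ _ D (prob_power D n) _ bFc).
apply: EFin_inj; rewrite !bint_EFin// integral_distribution//.
- by apply/measurable_EFinP; case: bF.
- exact: bmeas_integrable.
Qed.

End replace.

(** * Exponential moment of a single martingale difference *)

Lemma expR_le1Dx_norm {R : realType} (u v : R) : `|v| <= u ->
  expR v <= 1 + v + `|v| * (expR u - 1).
Proof.
move=> vu.
(* This is e^(-v) >= 1 - v multiplied by e^v. *)
have e1 : expR v <= 1 + v * expR v.
  have := expR_ge1Dx (- v); rewrite expRN => h.
  have := ler_wpM2r (ltW (expR_gt0 v)) h.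
  by rewrite mulVf ?gt_eqF ?expR_gt0// mulrBl mul1r => ?; lra.
have [v0|v0] := leP 0 v.
- rewrite ger0_norm// in vu *.
  have : v * expR v <= v * expR u by rewrite ler_wpM2l// ler_expR.
  by move=> ?; lra.
(* For negative v it remains to see 1 - e^v <= e^u - 1, which follows from 1 - e^v <= -v <= u <= e^u
   - 1. *)
- rewrite ltr0_norm// in vu *.
  have hu := expR_ge1Dx u; have hv := expR_ge1Dx v.
  have : - v * (1 - expR v) <= - v * (expR u - 1) by rewrite ler_wpM2l//; lra.
  by move=> ?; lra.
Qed.

Section martingale_difference.
Context {R : realType} {d} {X : measurableType d} (D : probability X R).

(** Exchanging the two integrals turns the double integral into its own negative. *)
Lemma bint_antisym (a : X * X -> R) : bmeas a ->
  (forall x z, a (x, z) = - a (z, x)) -> \int[D]_x \int[D]_z a (x, z) = 0.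
Proof.
move=> ba aN.
have bax x : bmeas (fun z => a (x, z)).
  by apply: (bmeas_comp ba); exact: measurable_pair1.
suff : \int[D]_x \int[D]_z a (x, z) = - \int[D]_x \int[D]_z a (x, z) by move=> ?; lra.
rewrite {1}bint_swap// -bintN; last exact: bmeas_bint.
apply: eq_Rintegral => z _; rewrite -bintN//.
by apply: eq_Rintegral => x _; exact: aN.
Qed.

(** A Bennett-type bound with the L1 norm in the role of the variance: the mean-zero condition kills
    the linear term of [expR_le1Dx_norm], the remainder is at most [tau * c], and 1 + x <= e^x
    concludes. *)
Lemma mgf_le (A : X -> R) (lam tau th : R) : bmeas A ->
  (forall x, `|A x| <= lam) -> \int[D]_x A x = 0 -> \int[D]_x `|A x| <= tau ->
  \int[D]_x expR (th * A x)
    <= expR (tau * (`|th| * (expR (`|th| * lam) - 1))).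
Proof.
move=> bA Alam A0 Atau.
set c := `|th| * (expR (`|th| * lam) - 1).
have lam0 : 0 <= `|th| * lam.
  by rewrite mulr_ge0// (le_trans _ (Alam point)).
have c0 : 0 <= c by rewrite mulr_ge0// subr_ge0 -expR0 ler_expR.
have bthA : bmeas (fun x => th * A x) by apply: bmeasM => //; exact: bmeas_cst.
have bcA : bmeas (fun x => c * `|A x|).
  by apply: bmeasM; [exact: bmeas_cst|exact: bmeas_norm].
have b1 : bmeas (fun x => 1 + th * A x).
  by apply: bmeasD => //; exact: bmeas_cst.
apply: (@le_trans _ _ (\int[D]_x (1 + th * A x + c * `|A x|))).
  apply: le_bint; [exact: bmeas_expR|exact: bmeasD|move=> x].
  have := @expR_le1Dx_norm _ (`|th| * lam) (th * A x).
  rewrite normrM ler_wpM2l// => /(_ isT) /le_trans; apply.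
  by rewrite lerD2l /c mulrAC.
rewrite bintD// bintD//; last exact: bmeas_cst.
rewrite bint_cst bintZ// A0 mulr0 addr0 bintZ; last exact: bmeas_norm.
rewrite (le_trans _ (expR_ge1Dx _))// lerD2l (mulrC tau) ler_wpM2l//.
Qed.
End martingale_difference.

(** * Approximation of f by a sum of bounded martingale differences *)

Section martingale_approximation.
Context {R : realType} {d} {X : measurableType d} (D : probability X R).

Local Notation mS := measurable_snd.
Local Notation mF := measurable_fst.

(* The differences are truncated into an abstract family a, rather than by an
   explicit formula, because the hypotheses on a must survive averaging over the
   first coordinate, and cutting at lam does not commute with averaging. *)
Lemma martingale_approximation (lam tau Delta : R) n (f : n.-tuple X -> R)
    (a : 'I_n -> n.-tuple X * X -> R) :
  bmeas f -> (forall i, bmeas (a i)) -> (forall i p, `|a i p| <= lam) ->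
  (forall i S z, a i (S, z) = - a i (tuple_replace S i z, tnth S i)) ->
  (forall i S, \int[D]_y \int[D]_z `|a i (tuple_replace S i y, z)| <= tau) ->
  (forall i, \int[D]_z \int[prob_power D n]_S
     `|f S - f (tuple_replace S i z) - a i (S, z)| <= Delta) ->
  exists G : n.-tuple X -> R, [/\ bmeas G,
    forall th, \int[prob_power D n]_S expR (th * G S)
      <= expR (tau * (`|th| * (expR (`|th| * lam) - 1))) ^+ n,
    \int[prob_power D n]_S `|G S| <= n%:R * tau &
    \int[prob_power D n]_S `|f S - \int[prob_power D n]_S' f S' - G S|
      <= n%:R * Delta].
Proof.
elim: n f a => [|n IHn] f a bf ba alam aN atau fDelta.
  (* There is only one empty tuple, so [f] equals its mean and nothing has to be approximated. *)
  exists (fun=> 0); split.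
  - exact: bmeas_cst.
  - by move=> th; rewrite mulr0 expR0 bint_cst expr0.
  - by rewrite normr0 bint_cst mul0r.
  - under eq_Rintegral => S _.
      rewrite (_ : \int[_]_S' f S' = f S); last first.
        rewrite -[RHS](bint_cst (prob_power D 0)); apply: eq_Rintegral => S' _.
        by rewrite (tuple0 S) (tuple0 S').
      rewrite subrr subr0 normr0.
      over.
    by rewrite bint_cst mul0r.
have mcons1 : measurable_fun setT
    (fun q : n.-tuple X * X => cons_pair (q.2, q.1) : n.+1.-tuple X).
  by apply: measurable_cons; [exact: mS|exact: mF].
have mconsx S : measurable_fun setT (fun x : X => cons_pair (x, S) : n.+1.-tuple X).
  by apply: measurable_cons => //; exact: measurable_id.
have mconsS x : measurable_fun setT (fun S => cons_pair (x, S) : n.+1.-tuple X).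
  by apply: measurable_cons => //; exact: measurable_id.
have bfx S : bmeas (fun x => f (cons_pair (x, S))) by exact: (bmeas_comp bf).
(* The coordinates are revealed from the last to the first. Averaging over the first one gives [g]
   and the family [a'], to which induction applies; [A] is the truncated martingale difference of
   the first coordinate. *)
pose g S := \int[D]_x f (cons_pair (x, S)).
have bg : bmeas g.
  have := bmeas_bint D (bmeas_comp bf mcons1); exact.
pose A S := \int[D]_z a ord0 (S, z).
have bA : bmeas A by exact: bmeas_bint.
have bax S : bmeas (fun z => a ord0 (S, z)).
  by apply: (bmeas_comp (ba _)); exact: measurable_pair1.
pose a' (i : 'I_n) (p : n.-tuple X * X) :=
  \int[D]_x a (lift ord0 i) (cons_pair (x, p.1), p.2).
have ba3 i : bmeas (fun q : (n.-tuple X * X) * X =>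
    a (lift ord0 i) (cons_pair (q.2, q.1.1), q.1.2)).
  apply: (bmeas_comp (ba _)); apply/measurable_fun_pair => /=.
    apply: measurable_cons; first exact: mS.
    exact: measurableT_comp mF mF.
  exact: measurableT_comp mS mF.
have ba' i : bmeas (a' i) by have := bmeas_bint D (ba3 i); exact.
have bax' i p : bmeas (fun x => a (lift ord0 i) (cons_pair (x, p.1), p.2)).
  apply: (bmeas_comp (ba3 i) (h := fun x => (p, x))).
  exact: measurable_pair1.
pose b i (p : n.+1.-tuple X * X) :=
  f p.1 - f (tuple_replace p.1 i p.2) - a i p.
have bb i : bmeas (b i).
  apply: bmeasB => //; apply: bmeasB; first exact: bmeas_comp bf mF.
  exact: bmeas_comp bf (measurable_tuple_replace i).
have bbn i : bmeas (fun p => `|b i p|) by exact: bmeas_norm.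
have [||||G' [bG' mgfG' G'tau gG']] := IHn g a' bg ba'.
- by move=> i p; apply: norm_bint_le.
- move=> i S z; rewrite /a'/= -bintN; last exact: (bax' i (_, _)).
  by apply: eq_Rintegral => x _; rewrite aN tuple_replaceS /cons_pair tnthS.
- move=> i S.
  have mrep : measurable_fun setT (fun q : X * X =>
      cons_pair (q.2, tuple_replace S i q.1) : n.+1.-tuple X).
    apply: measurable_cons; first exact: mS.
    exact: measurableT_comp (measurable_tuple_replace_at S i) mF.
  have bH : bmeas (fun q : (X * X) * X =>
      `|a (lift ord0 i) (cons_pair (q.1.2, tuple_replace S i q.1.1), q.2)|).
    apply: bmeas_norm; apply: (bmeas_comp (ba _)).
    apply/measurable_fun_pair => /=; last exact: mS.
    exact: measurableT_comp mrep mF.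
  have bH1 : bmeas (fun q : X * X => \int[D]_z
      `|a (lift ord0 i) (cons_pair (q.2, tuple_replace S i q.1), z)|).
    have := bmeas_bint D bH; exact.
  have bHy y : bmeas (fun q : X * X =>
      `|a (lift ord0 i) (cons_pair (q.2, tuple_replace S i y), q.1)|).
    apply: (bmeas_comp bH (h := fun q : X * X => ((y, q.2), q.1))).
    apply/measurable_fun_pair => /=; last exact: mF.
    by apply/measurable_fun_pair => /=; [exact: measurable_cst|exact: mS].
  have bL : bmeas (fun q : X * X => `|a' i (tuple_replace S i q.1, q.2)|).
    apply: bmeas_norm; apply: (bmeas_comp (ba' _)).
    apply/measurable_fun_pair => /=; last exact: mS.
    exact: measurableT_comp (measurable_tuple_replace_at S i) mF.
  (* The absolute value moves inside the average over x; once x is outermost, the hypothesis [atau]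
     applies for each fixed x. *)
  apply: (@le_trans _ _ (\int[D]_y \int[D]_x \int[D]_z
      `|a (lift ord0 i) (cons_pair (x, tuple_replace S i y), z)|)).
    apply: le_bint; first by have := bmeas_bint D bL; exact.
      by have := bmeas_bint D bH1; exact.
    move=> y.
    rewrite -(bint_swap D D (bHy y)) /=.
    apply: le_bint.
    - by apply: (bmeas_comp bL (h := fun z => (y, z))); exact: measurable_pair1.
    - by have := bmeas_bint D (bHy y); exact.
    - move=> z; apply: le_norm_bint; exact: (bax' i (_, _)).
  rewrite (bint_swap D D bH1) /=.
  have bH2 : bmeas (fun q : X * X => \int[D]_z
      `|a (lift ord0 i) (cons_pair (q.1, tuple_replace S i q.2), z)|).
    by apply: (bmeas_comp bH1 (h := fun q => (q.2, q.1))); exact: measurable_swap.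
  apply: bint_le_cst; first by have := bmeas_bint D bH2; exact.
  move=> x; have := atau (lift ord0 i) (cons_pair (x, S)).
  by under eq_Rintegral do under eq_Rintegral do rewrite tuple_replaceS.
- move=> i.
  (* The residual of [g] and [a'] is the x-average of the residual [b] of [f] and [a], so its L1
     norm is no larger. *)
  apply: le_trans (fDelta (lift ord0 i)).
  have bsw : bmeas (fun q : X * n.+1.-tuple X => `|b (lift ord0 i) (q.2, q.1)|).
    by apply: (bmeas_comp (bbn _) (h := fun q => (q.2, q.1))); exact: measurable_swap.
  have bgr : bmeas (fun p : n.-tuple X * X =>
      `|g p.1 - g (tuple_replace p.1 i p.2) - a' i p|).
    apply: bmeas_norm; apply: bmeasB => //; apply: bmeasB.
      exact: bmeas_comp bg mF.
    exact: bmeas_comp bg (measurable_tuple_replace i).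
  have bgs : bmeas (fun q : X * n.-tuple X =>
      `|g q.2 - g (tuple_replace q.2 i q.1) - a' i (q.2, q.1)|).
    by apply: (bmeas_comp bgr (h := fun q => (q.2, q.1))); exact: measurable_swap.
  apply: le_bint.
  - by have := bmeas_bint (prob_power D n) bgs; exact.
  - by have := bmeas_bint (prob_power D n.+1) bsw; exact.
  move=> z.
  have bbz : bmeas (fun S => `|b (lift ord0 i) (S, z)|).
    by apply: (bmeas_comp (bbn _)); exact: measurable_pair2.
  rewrite (bint_prob_power D bbz).
  have bbz1 : bmeas (fun q => `|b (lift ord0 i) (cons_pair (q.2, q.1), z)|).
    exact: (bmeas_comp bbz mcons1).
  apply: le_bint.
  - by apply: (bmeas_comp bgr (h := fun S => (S, z))); exact: measurable_pair2.
  - by have := bmeas_bint D bbz1; exact.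
  move=> S.
  have bbS : bmeas (fun x => b (lift ord0 i) (cons_pair (x, S), z)).
    apply: (bmeas_comp (bb _) (h := fun x => (cons_pair (x, S), z))).
    by apply/measurable_fun_pair => /=.
  apply: le_trans (le_norm_bint D bbS).
  rewrite le_eqVlt; apply/orP; left; apply/eqP; congr `|_|.
  rewrite /g /a' -!bintB//.
  + by apply: eq_Rintegral => x _; rewrite /b /= tuple_replaceS.
  + exact: bmeasB.
pose tl (S : n.+1.-tuple X) : n.-tuple X := [tuple of behead S].
have tlE x S : tl (cons_pair (x, S)) = S by exact: val_inj.
have mtl : measurable_fun setT tl by exact: measurable_behead.
have bG't : bmeas (fun S => G' (tl S)) by exact: bmeas_comp bG' mtl.
have bgt : bmeas (fun S => g (tl S)) by exact: bmeas_comp bg mtl.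
have bAx S : bmeas (fun x => A (cons_pair (x, S))) by exact: bmeas_comp bA (mconsx S).
have inttl (h : n.-tuple X -> R) : bmeas h ->
    \int[prob_power D n.+1]_S h (tl S) = \int[prob_power D n]_S h S.
  move=> bh; rewrite bint_prob_power; last exact: bmeas_comp bh mtl.
  apply: eq_Rintegral => S _; rewrite -[RHS](bint_cst D).
  by apply: eq_Rintegral => x _; rewrite tlE.
(* At the first coordinate, [aN] is antisymmetry in (x, z) with the tail fixed, so the truncated
   difference is still centred given the tail. *)
have A0 S : \int[D]_x A (cons_pair (x, S)) = 0.
  have ba0 : bmeas (fun p : X * X => a ord0 (cons_pair (p.1, S), p.2)).
    apply: (bmeas_comp (ba _)); apply/measurable_fun_pair => /=; last exact: mS.
    exact: measurableT_comp (mconsx S) mF.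
  by apply: (bint_antisym D ba0) => x z /=; rewrite aN tuple_replace0 /cons_pair tnth0.
have bA2 S : bmeas (fun p : X * X => `|a ord0 (cons_pair (p.1, S), p.2)|).
  apply: bmeas_norm; apply: (bmeas_comp (ba _)).
  apply/measurable_fun_pair => /=; last exact: mS.
  exact: measurableT_comp (mconsx S) mF.
have Atau S : \int[D]_x `|A (cons_pair (x, S))| <= tau.
  (* [point] is a placeholder: the first coordinate is overwritten by y. *)
  apply: le_trans (atau ord0 (cons_pair (point, S))).
  under [leRHS]eq_Rintegral do under eq_Rintegral do rewrite tuple_replace0.
  apply: le_bint; first exact: bmeas_norm.
  - by have := bmeas_bint D (bA2 S); exact.
  - by move=> x; apply: le_norm_bint.
exists (fun S => A S + G' (tl S)); split.
- exact: bmeasD.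
- move=> th.
  have bthA : bmeas (fun S => expR (th * A S)).
    by apply: bmeas_expR; apply: bmeasM => //; exact: bmeas_cst.
  have bthG : bmeas (fun S => expR (th * G' S)).
    by apply: bmeas_expR; apply: bmeasM => //; exact: bmeas_cst.
  have bthGt : bmeas (fun S => expR (th * G' (tl S))) by exact: bmeas_comp bthG mtl.
  under eq_Rintegral do rewrite mulrDr expRD.
  have bAG : bmeas (fun S => expR (th * A S) * expR (th * G' (tl S))) by exact: bmeasM.
  (* Given the tail, the exponential of [G'] is a constant, and the integral over x of the other
     factor is at most [M] by [mgf_le]. *)
  rewrite bint_prob_power//; set M := expR _.
  rewrite exprS (le_trans _ (ler_wpM2l _ (mgfG' th))) ?expR_ge0// -bintZ//.
  apply: le_bint.
  - by have := bmeas_bint D (bmeas_comp bAG mcons1); exact.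
  - by apply: bmeasM => //; exact: bmeas_cst.
  move=> S; under eq_Rintegral do rewrite tlE mulrC.
  rewrite bintZ; last exact: bmeas_comp bthA (mconsx S).
  rewrite mulrC ler_wpM2r ?expR_ge0//.
  by apply: (mgf_le th (bAx S) _ (A0 S) (Atau S)) => x; exact: norm_bint_le.
- have bnA : bmeas (fun S => `|A S|) by exact: bmeas_norm.
  have bnG : bmeas (fun S => `|G' (tl S)|) by exact: bmeas_norm.
  apply: (@le_trans _ _ (\int[prob_power D n.+1]_S (`|A S| + `|G' (tl S)|))).
    apply: le_bint; [exact/bmeas_norm/bmeasD|exact: bmeasD|].
    by move=> S; exact: ler_normD.
  rewrite bintD// (inttl (fun S => `|G' S|)); last exact: bmeas_norm.
  rewrite mulrSr mulrDl mul1r addrC lerD// bint_prob_power//.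
  apply: bint_le_cst => //.
  by have := bmeas_bint D (bmeas_comp bnA mcons1); exact.
- have Efg : \int[prob_power D n.+1]_S f S = \int[prob_power D n]_S g S.
    exact: bint_prob_power.
  rewrite Efg; set Eg := \int[_]_S g S.
  have bn1 : bmeas (fun S => `|f S - g (tl S) - A S|).
    by apply: bmeas_norm; apply: bmeasB => //; exact: bmeasB.
  have bn2 : bmeas (fun S => `|g S - Eg - G' S|).
    by apply: bmeas_norm; apply: bmeasB => //; apply: bmeasB => //; exact: bmeas_cst.
  have bn2t : bmeas (fun S => `|g (tl S) - Eg - G' (tl S)|).
    exact: bmeas_comp bn2 mtl.
  (* The residual splits into that of the first coordinate, of L1 norm at most [Delta], and the
     inductive one for [g], of L1 norm at most [n%:R * Delta]. *)
  apply: (@le_trans _ _ (\int[prob_power D n.+1]_S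
      (`|f S - g (tl S) - A S| + `|g (tl S) - Eg - G' (tl S)|))).
    apply: le_bint; [|exact: bmeasD|].
      apply: bmeas_norm; apply: bmeasB; last exact: bmeasD.
      by apply: bmeasB => //; exact: bmeas_cst.
    move=> S; apply: le_trans (ler_normD _ _).
    by rewrite le_eqVlt; apply/orP; left; apply/eqP; congr `|_|; ring.
  rewrite bintD// (inttl (fun S => `|g S - Eg - G' S|))//.
  rewrite mulrSr mulrDl mul1r addrC lerD//.
  apply: le_trans (fDelta ord0).
  rewrite -(bint_swap (prob_power D n.+1) D (bbn ord0)).
  apply: le_bint => //; first by have := bmeas_bint D (bbn ord0); exact.
  move=> S.
  have bbS : bmeas (fun z => b ord0 (S, z)).
    by apply: (bmeas_comp (bb _)); exact: measurable_pair1.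
  apply: le_trans (le_norm_bint D bbS).
  rewrite le_eqVlt; apply/orP; left; apply/eqP; congr `|_|.
  (* Resampling the first coordinate computes [g (tl S)], so the first residual is the z-average of
     [b ord0]. *)
  have gE : g (tl S) = \int[D]_z f (tuple_replace S ord0 z).
    apply: eq_Rintegral => z _; congr f.
    have -> : S = cons_pair (thead S, tl S) by exact: tuple_eta.
    by rewrite tuple_replace0 tlE.
  have bfr : bmeas (fun z => f (tuple_replace S ord0 z)).
    exact: bmeas_comp bf (measurable_tuple_replace_at S ord0).
  rewrite gE /A -[f S](bint_cst D) -!bintB//; last exact: bmeas_cst.
  by apply: bmeasB => //; exact: bmeas_cst.
Qed.
End martingale_approximation.

(** * Clipping a function to a bounded range *)

Section clip.
Context {R : realType}.

Definition clip (K x : R) : R := Num.max (- K) (Num.min K x).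

Lemma clipE K x : 0 <= K ->
  clip K x = if K <= x then K else if x <= - K then - K else x.
Proof.
move=> K0; rewrite /clip; case: (leP K x) => ?; first by rewrite max_r//; lra.
by case: (leP x (- K)) => // ?; rewrite max_r// ltW.
Qed.

Lemma clip_bound K x : 0 <= K -> `|clip K x| <= K.
Proof.
move=> K0; rewrite clipE//.
by case: (leP K x) => ?; [|case: (leP x (- K)) => ?]; rewrite ler_norml; lra.
Qed.

Lemma clip_id K x : `|x| <= K -> clip K x = x.
Proof.
by rewrite ler_norml => /andP[? ?]; rewrite /clip min_r// max_r.
Qed.

Lemma le_norm_clip K x : 0 <= K -> `|clip K x| <= `|x|.
Proof.
move=> K0; have [xK|Kx] := leP `|x| K; first by rewrite clip_id.
by rewrite (le_trans (clip_bound _ K0)) // ltW.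
Qed.

Lemma clip_lip K x y : 0 <= K -> `|clip K x - clip K y| <= `|x - y|.
Proof.
move=> K0; wlog yx : x y / y <= x.
  move=> h; have [|/ltW] := leP y x; first exact: h.
  by rewrite distrC (distrC x); exact: h.
rewrite (ger0_norm (_ : 0 <= x - y)); last by lra.
rewrite !clipE//; case: (leP K x) => ?; case: (leP K y) => ?;
  case: (leP x (- K)) => ?; case: (leP y (- K)) => ?; rewrite ler_norml; lra.
Qed.

Lemma measurable_clip K : measurable_fun setT (clip K).
Proof. by apply: measurable_maxr => //; exact: measurable_minr. Qed.

(** Dominated convergence with dominating function |f|: at each point the clipped values are
    eventually equal to the value of [f]. *)
Lemma clip_L1 d (T : measurableType d) (P : probability T R) (f : T -> R) eta :
  P.-integrable setT (EFin \o f) -> 0 < eta ->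
  exists2 K, 0 <= K & \int[P]_x `|clip K (f x) - f x| < eta.
Proof.
move=> intf eta0.
have mf : measurable_fun setT f.
  by apply/measurable_EFinP; case/integrableP : intf.
have [] := @dominated_convergence _ T R P setT measurableT
  (fun k x => (clip k%:R (f x))%:E) (EFin \o f) (fun x => `|f x|%:E).
- move=> k; apply/measurable_EFinP.
  by apply: measurableT_comp => //; exact: measurable_clip.
- exact/measurable_EFinP.
- apply: aeW => x _; apply: cvg_near_cst.
  near=> k; rewrite /= clip_id//; near: k.
  exact: nbhs_infty_ger.
- by have := integrable_norm intf.
- by apply: aeW => x k _; rewrite /= lee_fin le_norm_clip.
move=> _ /fine_cvgP[[N _ Nfin] /cvgrPdist_lt /(_ _ eta0)[M _ HM]] _.
exists (maxn N M)%:R => //.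
have := HM (maxn N M) (leq_maxr _ _).
by rewrite /= sub0r normrN; apply: le_lt_trans; exact: ler_norm.
Unshelve. all: by end_near.
Qed.

End clip.

(** * Markov's inequality and a numerical bound on e *)

Lemma measurable_le_norm {R : realType} {d} {T : measurableType d}
    (h : T -> R) (t : R) : measurable_fun setT h ->
  measurable [set x | t <= `|h x|].
Proof.
move=> mh; rewrite -[X in measurable X]setTI.
rewrite (_ : [set _ | _] = (fun x => `|h x|) @^-1` `[t, +oo[%classic).
  by apply: measurableT_comp.
by apply/seteqP; split => S /=; rewrite in_itv/= andbT.
Qed.

Lemma markov_bint {R : realType} {d} {T : measurableType d} (P : probability T R)
    (h : T -> R) (t : R) : 0 < t -> P.-integrable setT (EFin \o h) ->
  (P [set x | (t <= `|h x|)%R] <= (\int[P]_x `|h x| / t)%:E)%E.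
Proof.
move=> t0 ih.
have mh : measurable_fun setT (EFin \o h) by case/integrableP : ih.
have := @le_integral_comp_abse _ T R P setT measurableT (EFin \o h) t id
  (@measurable_id _ _ _) (fun r r0 => r0) (fun x y _ _ xy => xy) mh t0.
rewrite setTI => H.
rewrite EFinM lee_pdivlMr// muleC /Rintegral fineK//.
exact: integrable_fin_num (integrable_norm ih).
Qed.

Lemma expR1_le4 {R : realType} : expR 1 <= 4 :> R.
Proof.
have := expR_ge1Dx (- (2^-1) : R); rewrite expRN => h.
have e0 := expR_gt0 (2^-1 : R).
(* The inequality 1 + x <= e^x at x = -1/2 gives e^(-1/2) >= 1/2; squaring the inverse yields e <=
   4. *)
have : expR (2^-1 : R) <= 2.
  have := ler_wpM2r (ltW e0) h; rewrite mulVf ?gt_eqF// => ?; lra.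
move=> e2; rewrite (_ : 1 = 2%:R * 2^-1 :> R); last by rewrite mulfV.
by rewrite expRM_natl expr2; nra.
Qed.

(** * Truncation at [lam] and the tail bound *)

Section truncated_differences.
Context {R : realType} {d} {X : measurableType d} (D : probability X R).

Lemma measurable_truncated d' (U : measurableType d') (lam : R) (g h : U -> R) :
  measurable_fun setT g -> measurable_fun setT h ->
  measurable_fun setT (fun p => (g p <= lam)%R%:R * h p).
Proof.
move=> mg mh.
rewrite [X in measurable_fun _ X](_ : _ =
    fun p => if g p <= lam then h p else 0); last first.
  by apply/funext => p; case: ifP => _; rewrite ?mul1r ?mul0r.
by apply: measurable_fun_ifT => //; exact: measurable_fun_ler.
Qed.

Variables (n : nat) (f : n.-tuple X -> R) (Delta lam tau : R).
Hypothesis mf : measurable_fun setT f.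
Hypothesis intf : (prob_power D n).-integrable setT (EFin \o f).
Hypotheses (n1 : (1 <= n)%N) (Delta0 : 0 < Delta) (lam0 : 0 < lam).
Hypothesis fDelta : forall i : 'I_n,
  ('E_(prob_power D n \x D)[fun p : n.-tuple X * X =>
        (let diff : R := `|f p.1 - f (tuple_replace p.1 i p.2)| in
         (lam < diff)%R%:R * diff)%R] <= Delta%:E)%E.
Hypothesis ftau : forall (S : n.-tuple X) (i : 'I_n),
  ('E_(D \x D)[fun p : X * X =>
          (let diff : R :=
             `|f (tuple_replace S i p.1) - f (tuple_replace S i p.2)| in
           (diff <= lam)%R%:R * diff)%R] <= tau%:E)%E.

(** Clipping is 1-Lipschitz, so both hypotheses on the differences of [f] pass to the clipped
    function with the same constants. *)
Lemma clipped_approximation K : 0 <= K ->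
  exists G : n.-tuple X -> R, [/\ bmeas G,
    forall th, \int[prob_power D n]_S expR (th * G S)
      <= expR (tau * (`|th| * (expR (`|th| * lam) - 1))) ^+ n,
    \int[prob_power D n]_S `|G S| <= n%:R * tau &
    \int[prob_power D n]_S
      `|clip K (f S) - \int[prob_power D n]_S' clip K (f S') - G S|
      <= n%:R * Delta].
Proof.
move=> K0.
have bfK : bmeas (fun S => clip K (f S)).
  split; first by apply: measurableT_comp mf; exact: measurable_clip.
  by exists K => S; exact: clip_bound.
have mf1 : measurable_fun setT (fun p : n.-tuple X * X => f p.1).
  exact: measurableT_comp mf measurable_fst.
have mf2 i : measurable_fun setT
    (fun p : n.-tuple X * X => f (tuple_replace p.1 i p.2)).
  exact: measurableT_comp mf (measurable_tuple_replace i).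
pose dif i (p : n.-tuple X * X) := `|f p.1 - f (tuple_replace p.1 i p.2)|.
have mdif i : measurable_fun setT (dif i).
  by apply: measurableT_comp => //; exact: measurable_funB.
(* The indicator tests the difference of [f] itself, as in the hypotheses, and multiplies the
   clipped difference; being symmetric in the two points, it preserves antisymmetry. *)
pose a i (p : n.-tuple X * X) :=
  (dif i p <= lam)%R%:R * (clip K (f p.1) - clip K (f (tuple_replace p.1 i p.2))).
have alam i p : `|a i p| <= lam.
  rewrite /a normrM; have [h|_] := leP (dif i p); last by rewrite normr0 mul0r ltW.
  by rewrite normr1 mul1r (le_trans _ h)// clip_lip.
have ba i : bmeas (a i).
  split; last by exists lam.
  apply: measurable_truncated => //.
  by apply: measurable_funB; apply: measurableT_comp => //; exact: measurable_clip.
apply: (martingale_approximation bfK ba alam).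
- move=> i S z; rewrite /a /dif /= tuple_replaceK tuple_replace_tnth distrC.
  by rewrite -mulrN opprB.
- move=> i S.
  have mS : measurable_fun setT (fun q : X * X => tuple_replace S i q.1).
    exact: measurableT_comp (measurable_tuple_replace_at S i) measurable_fst.
  have mS2 : measurable_fun setT (fun q : X * X => tuple_replace S i q.2).
    exact: measurableT_comp (measurable_tuple_replace_at S i) measurable_snd.
  have bF : bmeas (fun q : X * X => `|a i (tuple_replace S i q.1, q.2)|).
    apply: bmeas_norm; apply: (bmeas_comp (ba i)).
    by apply/measurable_fun_pair => //=; exact: measurable_snd.
  (* [bint_prod] has the second variable outermost, hence the swap first. *)
  rewrite (bint_swap D D bF) -(bint_prod D D bF) -lee_fin (bint_EFin _ bF).
  apply: le_trans (ftau S i); rewrite unlock; apply: ge0_le_integral => //.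
  + by apply/measurable_EFinP; case: bF.
  + apply/measurable_EFinP.
    have md : measurable_fun setT (fun q : X * X =>
        `|f (tuple_replace S i q.1) - f (tuple_replace S i q.2)|).
      by apply: measurableT_comp => //; apply: measurable_funB; exact: measurableT_comp.
    exact: measurable_truncated.
  + move=> q _; rewrite lee_fin /a /dif /= tuple_replaceK normrM ger0_norm//.
    by rewrite ler_wpM2l// clip_lip.
- move=> i.
  have bF : bmeas (fun q : n.-tuple X * X =>
      `|clip K (f q.1) - clip K (f (tuple_replace q.1 i q.2)) - a i q|).
    apply: bmeas_norm; apply: bmeasB => //; apply: bmeasB.
      exact: bmeas_comp bfK measurable_fst.
    exact: bmeas_comp bfK (measurable_tuple_replace i).
  rewrite -(bint_prod (prob_power D n) D bF) -lee_fin (bint_EFin _ bF).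
  apply: le_trans (fDelta i); rewrite unlock; apply: ge0_le_integral => //.
  + by apply/measurable_EFinP; case: bF.
  + apply/measurable_EFinP.
    rewrite [X in measurable_fun _ X](_ : _ =
      fun p => dif i p - (dif i p <= lam)%R%:R * dif i p); last first.
      apply/funext => p; rewrite /= -/(dif i p) ltNge.
      by case: (_ <= _); rewrite /= ?mul1r ?mul0r ?subrr ?subr0.
    by apply: measurable_funB => //; exact: measurable_truncated.
  + move=> q _; rewrite lee_fin /a /= -/(dif i q) ltNge.
    case: (dif i q <= lam); rewrite /= ?mul1r ?mul0r ?subrr ?subr0 ?normr0//.
    exact: clip_lip.
Qed.

Lemma L1_approximation :
  exists G : n.-tuple X -> R, [/\ bmeas G,
    forall th, \int[prob_power D n]_S expR (th * G S)
      <= expR (tau * (`|th| * (expR (`|th| * lam) - 1))) ^+ n,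
    \int[prob_power D n]_S `|G S| <= n%:R * tau &
    \int[prob_power D n]_S `|f S - \int[prob_power D n]_S' f S' - G S|
      <= n%:R * Delta * 2].
Proof.
(* This clipping error is paid twice, for [f] and for its mean; with the residual of the clipped
   function the total is [n%:R * Delta * 2]. *)
have nD : 0 < n%:R * Delta / 2 by rewrite divr_gt0// mulr_gt0// ltr0n.
have [K K0 fK] := clip_L1 intf nD.
have [G [bG mgfG Gtau GDelta]] := clipped_approximation K0.
exists G; split => //.
set c := Rintegral _ _ f.
set cK := Rintegral _ _ (fun S => clip K (f S)) in GDelta.
have bfK : bmeas (fun S => clip K (f S)).
  split; first by apply: measurableT_comp mf; exact: measurable_clip.
  by exists K => S; exact: clip_bound.
have ifK : (prob_power D n).-integrable setT (EFin \o (fun S => clip K (f S) - f S)).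
  exact: integrableB (bmeas_integrable _ bfK) intf.
have ifKn : (prob_power D n).-integrable setT (EFin \o (fun S => `|clip K (f S) - f S|)).
  exact: integrable_norm ifK.
have bcst (r : R) : (prob_power D n).-integrable setT (EFin \o (fun=> r)).
  by apply: bmeas_integrable; exact: bmeas_cst.
have bN : bmeas (fun S => `|clip K (f S) - cK - G S|).
  by apply: bmeas_norm; apply: bmeasB => //; apply: bmeasB => //; exact: bmeas_cst.
have iN := bmeas_integrable (prob_power D n) bN.
have iL : (prob_power D n).-integrable setT (EFin \o (fun S => `|f S - c - G S|)).
  apply: (@integrable_norm _ _ _ _ _ (fun S => f S - c - G S)).
  have := integrableB measurableT (integrableB measurableT intf (bcst c))
     (bmeas_integrable _ bG); exact.
have iD : (prob_power D n).-integrable setT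
    (EFin \o (fun S => `|clip K (f S) - f S| + `|clip K (f S) - cK - G S|)).
  by have := integrableD measurableT ifKn iN; exact.
have cKc : `|cK - c| <= \int[prob_power D n]_S `|clip K (f S) - f S|.
  rewrite -RintegralB//; last exact: bmeas_integrable.
  exact: le_normr_Rintegral.
apply: (@le_trans _ _ (\int[prob_power D n]_S
    (`|clip K (f S) - f S| + `|clip K (f S) - cK - G S| + `|cK - c|))).
  apply: le_Rintegral => //.
    by have := integrableD measurableT iD (bcst `|cK - c|); exact.
  move=> S _; rewrite -(distrC (f S)).
  rewrite (_ : f S - c - G S =
    (f S - clip K (f S)) + (clip K (f S) - cK - G S) + (cK - c)); last by ring.
  by rewrite (le_trans (ler_normD _ _))// lerD2r ler_normD.
rewrite RintegralD// RintegralD// bint_cst.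
by move: fK cKc GDelta; lra.
Qed.

(** Chernoff's method with parameters u / lam and -(u / lam), one for each sign of [G]; these make
    |th| * lam equal to u. *)
Lemma mgf_tail (G : n.-tuple X -> R) (T u : R) : bmeas G -> 0 <= u ->
  (forall th, \int[prob_power D n]_S expR (th * G S)
    <= expR (tau * (`|th| * (expR (`|th| * lam) - 1))) ^+ n) ->
  (prob_power D n [set S | (T <= `|G S|)%R]
    <= (2 * expR (- (T - n%:R * tau * (expR u - 1)) * (u / lam)))%:E)%E.
Proof.
move=> bG u0 mgfG; set B := expR _.
have ul0 : 0 <= u / lam by rewrite divr_ge0// ltW.
have bE th : bmeas (fun S => expR (th * G S)).
  by apply: bmeas_expR; apply: bmeasM => //; exact: bmeas_cst.
have mE th : measurable [set S | (expR (u / lam * T) <= `|expR (th * G S)|)%R].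
  by apply: measurable_le_norm; case: (bE th).
have half th : `|th| = u / lam ->
    (prob_power D n [set S | (expR (u / lam * T) <= `|expR (th * G S)|)%R] <= B%:E)%E.
  move=> thE; apply: le_trans (markov_bint (expR_gt0 _) (bmeas_integrable _ (bE th))) _.
  rewrite lee_fin ler_pdivrMr ?expR_gt0//.
  under eq_Rintegral do rewrite ger0_norm ?expR_ge0//.
  apply: le_trans (mgfG th) _; rewrite thE divfK ?gt_eqF// -expRM_natl -expRD ler_expR.
  by rewrite le_eqVlt; apply/orP; left; apply/eqP; ring.
rewrite mulr2n mulrDl mul1r EFinD.
apply: le_trans (leeD (half (u / lam) (ger0_norm ul0)) (half (- (u / lam)) _)); last first.
  by rewrite normrN ger0_norm.
apply: le_trans (measureU2 _ (mE _) (mE _)).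
apply: le_measure; rewrite ?inE//.
- by apply: measurable_le_norm; case: bG.
- exact: measurableU.
move=> S /=; rewrite !(ger0_norm (expR_ge0 _)) !ler_expR.
have [G0|G0] := leP 0 (G S) => TG.
  by left; rewrite ler_wpM2l// -(ger0_norm G0).
by right; rewrite mulNr -mulrN ler_wpM2l// -(ltr0_norm G0).
Qed.

Hypotheses (tau0 : 0 < tau).

Lemma tail_bound (eps : R) : 0 < eps ->
  lam / (eps * Num.min 1 eps * tau) * ln (tau * Num.min 1 eps / Delta) <= n%:R ->
  (prob_power D n [set S |
      (18 * eps * tau * n%:R <= `|f S - \int[prob_power D n]_S' f S'|)%R]
    < (14 * Delta / (eps * tau))%:E)%E.
Proof.
move=> eps0 hn.
have n0 : 0 < n%:R :> R by rewrite ltr0n.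
have [G [bG mgfG Gtau GDelta]] := L1_approximation.
set c := Rintegral _ _ f in GDelta *.
set r := Delta / (eps * tau).
have r0 : 0 < r by rewrite divr_gt0// mulr_gt0.
have -> : 14 * Delta / (eps * tau) = 14 * r by rewrite /r mulrA.
(* The threshold 18 is split as 17 + 1: Markov's inequality bounds the residual at level
   [eps * tau * n%:R] by [2 * r], which leaves [12 * r] for [G]. *)
suff [q qr Gq] : exists2 q : R, q < 12 * r &
    (prob_power D n [set S | (17 * eps * tau * n%:R <= `|G S|)%R] <= q%:E)%E.
  have ifG : (prob_power D n).-integrable setT (EFin \o (fun S => f S - c - G S)).
    have bcst : (prob_power D n).-integrable setT (EFin \o (fun=> c)).
      by apply: bmeas_integrable; exact: bmeas_cst.
    have := integrableB measurableT (integrableB measurableT intf bcst)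
      (bmeas_integrable _ bG); exact.
  have etn0 : 0 < eps * tau * n%:R by rewrite !mulr_gt0.
  have H2 := markov_bint etn0 ifG.
  have mfG : measurable_fun setT (fun S => f S - c - G S).
    by apply/measurable_EFinP; case/integrableP : ifG.
  have mfc : measurable_fun setT (fun S => f S - c).
    exact: measurable_funB.
  have bGm : measurable_fun setT G by case: bG.
  apply: (@le_lt_trans _ _ (q + 2 * r)%:E); last by rewrite lte_fin; lra.
  rewrite EFinD; apply: le_trans (leeD Gq (le_trans H2 _)); last first.
    rewrite lee_fin ler_pdivrMr// (le_trans GDelta)// le_eqVlt; apply/orP; left.
    by apply/eqP; rewrite /r; field; rewrite !gt_eqF.
  apply: le_trans (measureU2 _ (measurable_le_norm _ bGm) (measurable_le_norm _ mfG)).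
  apply: le_measure; rewrite ?inE; first exact: measurable_le_norm.
    by apply: measurableU; exact: measurable_le_norm.
  move=> S /= h18.
  have [h17|h17] := leP (17 * eps * tau * n%:R) `|G S|; [by left|right].
  have := ler_normB (f S - c - G S) (- G S).
  rewrite opprK subrK normrN => h; lra.
pose m := eps * tau * n%:R / lam.
have m0 : 0 < m by rewrite divr_gt0// !mulr_gt0.
have mn0 : 0 < Num.min 1 eps by rewrite lt_min ltr01.
have hm : ln (tau * Num.min 1 eps / Delta) <= Num.min 1 eps * m.
  have c0 : 0 < lam / (eps * Num.min 1 eps * tau) by rewrite divr_gt0// !mulr_gt0.
  rewrite -(ler_pM2l c0) (le_trans hn)// le_eqVlt; apply/orP; left; apply/eqP.
  by rewrite /m; field; rewrite !gt_eqF.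
(* The Chernoff exponent is then at least (17 - 4) * m * u >= m * u >= - ln r, which gives the bound
   [2 * r]. *)
have expm u : 0 <= u -> expR u - 1 <= 4 * eps -> - ln r <= m * u ->
    exists2 q : R, q < 12 * r &
      (prob_power D n [set S | (17 * eps * tau * n%:R <= `|G S|)%R] <= q%:E)%E.
  move=> u0 ue ru.
  exists (2 * r); first by lra.
  apply: le_trans (mgf_tail (17 * eps * tau * n%:R) bG u0 mgfG) _.
  rewrite lee_fin ler_pM2l// -[leRHS]lnK ?posrE// ler_expR.
  rewrite mulNr lerNl (le_trans ru)// /m.
  rewrite [leLHS](_ : _ = eps * tau * n%:R * (u / lam)); last by field; rewrite gt_eqF.
  rewrite ler_wpM2r//; first by rewrite divr_ge0// ltW.
  have : n%:R * tau * (expR u - 1) <= n%:R * tau * (4 * eps).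
    by rewrite ler_wpM2l// mulr_ge0// ltW.
  have : 0 < eps * tau * n%:R by rewrite !mulr_gt0.
  by move=> ? ?; lra.
have rE : - ln r = ln (tau * eps / Delta).
  by rewrite -lnV ?posrE// /r invf_div (mulrC tau).
have [eps1|eps1] := leP eps 1.
  rewrite min_r// -rE in hm.
  (* With u = eps <= 1, e^eps - 1 <= eps + eps * (e - 1) <= 4 * eps. *)
  apply: (expm eps); [exact: ltW| |by rewrite mulrC].
  have := expR_le1Dx_norm (lexx `|eps|); rewrite (ger0_norm (ltW eps0)) => h.
  have : eps * (expR eps - 1) <= eps * 3.
    rewrite ler_pM2l// lerBlDr (_ : 3 + 1 = 4); last by ring.
    by rewrite (le_trans _ expR1_le4)// ler_expR.
  by move: h; lra.
rewrite (min_l (ltW eps1)) mulr1 mul1r in hm.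
have [L1|L1] := leP 1 (ln (tau / Delta)).
  have lneps : 0 <= ln eps by rewrite ln_ge0// ltW.
  (* Here e^u = e * eps, and [- ln r] is ln (tau / Delta) + ln eps; the first term is at most m by
     [hm], the second at most m * ln eps because m >= 1. *)
  apply: (expm (1 + ln eps)); first by lra.
    rewrite expRD lnK ?posrE//.
    have : expR 1 * eps <= 4 * eps by rewrite ler_pM2r// expR1_le4.
    by lra.
  rewrite rE mulrAC lnM ?posrE ?divr_gt0// mulrDr mulr1 lerD//.
  by rewrite ler_peMl// (le_trans L1).
(* First-moment bound, equal to 1 / (17 * eps). Now tau < e * Delta <= 4 * Delta, so [12 * r]
   exceeds 3 / eps. *)
exists (n%:R * tau / (17 * eps * tau * n%:R)).
  have tD : tau / Delta < 4.
    by rewrite -[ltLHS]lnK ?posrE ?divr_gt0// (lt_le_trans _ expR1_le4)// ltr_expR.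
  rewrite ltr_pdivrMr// in tD.
  rewrite [ltLHS](_ : _ = (17 * eps)^-1); last by field; rewrite !gt_eqF.
  rewrite /r mulrA ltr_pdivlMr ?mulr_gt0// [ltLHS](_ : _ = tau / 17); last first.
    by field; rewrite gt_eqF.
  by move: tD Delta0; lra.
have T0 : 0 < 17 * eps * tau * n%:R by rewrite !mulr_gt0.
apply: le_trans (markov_bint T0 (bmeas_integrable _ bG)) _.
by rewrite lee_fin ler_pM2r ?invr_gt0.
Qed.
End truncated_differences.

(** * Deduction of both tail estimates with C = 1 *)

Unset Implicit Arguments.
Set Strict Implicit.

Theorem theorem1p2 (R : realType) :
  exists C : R, 0 < C /\
  forall (d : measure_display) (X : measurableType d) (D : probability X R)
    (n : nat) (f : n.-tuple X -> R) (Delta lambda : R),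
  let Dn := prob_power D n in
  let fDn := fine 'E_Dn[f] in
  (1 <= n)%N ->
  measurable_fun setT f ->
  Dn.-integrable setT (EFin \o f) ->
  0 < Delta -> 0 < lambda ->
  (forall i : 'I_n,
    ('E_(Dn \x D)[fun p : n.-tuple X * X =>
        (let diff : R := `|f p.1 - f (tuple_replace p.1 i p.2)| in
         (lambda < diff)%R%:R * diff)%R] <= Delta%:E)%E) ->
  (* Part 1 *)
  (forall eps : R, 0 < eps ->
    C * (1 / (eps * Num.min 1 eps)) * ln (lambda * Num.min 1 eps / Delta)
      <= n%:R ->
    (Dn [set S | (18 * eps * lambda * n%:R <= `|f S - fDn|)%R]
      < (14 * Delta / (eps * lambda))%:E)%E)
  /\
  (* Part 2 *)
  (forall tau : R, 0 < tau -> tau <= lambda ->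
    (forall (S : n.-tuple X) (i : 'I_n),
      ('E_(D \x D)[fun p : X * X =>
          (let diff : R :=
             `|f (tuple_replace S i p.1) - f (tuple_replace S i p.2)| in
           (diff <= lambda)%R%:R * diff)%R] <= tau%:E)%E) ->
    forall eps : R, 0 < eps ->
    C * (lambda / (eps * Num.min 1 eps * tau))
        * ln (tau * Num.min 1 eps / Delta) <= n%:R ->
    (Dn [set S | (18 * eps * tau * n%:R <= `|f S - fDn|)%R]
      < (14 * Delta / (eps * tau))%:E)%E).
Proof.
exists 1; split=> // d X D n f Delta lambda Dn fDn n1 mf intf D0 l0 fDelta.
have fDnE : fDn = \int[Dn]_S f S by rewrite /fDn unlock.
have part2 := tail_bound mf intf n1 D0 l0 fDelta.
split=> [eps eps0 hn|tau tau0 _ ftau eps eps0 hn]; rewrite fDnE; last first.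
  by apply: (part2 tau) => //; rewrite mul1r in hn.
(* With tau = lambda the condition on n reduces to that of Part 1, and the condition on the
   truncated differences holds because they are at most lambda pointwise. *)
apply: (part2 lambda) => //; last first.
  rewrite (le_trans _ hn)// le_eqVlt; apply/orP; left; apply/eqP.
  have : 0 < Num.min 1 eps by rewrite lt_min ltr01.
  move: (ln _) => L; move: (Num.min 1 eps) => m m0.
  by field; rewrite !gt_eqF.
move=> S i; rewrite unlock.
have mdif : measurable_fun setT (fun p : X * X =>
    `|f (tuple_replace S i p.1) - f (tuple_replace S i p.2)|).
  apply: measurableT_comp => //; apply: measurable_funB.
    apply: measurableT_comp mf _.
    exact: measurableT_comp (measurable_tuple_replace_at S i) measurable_fst.
  apply: measurableT_comp mf _.
  exact: measurableT_comp (measurable_tuple_replace_at S i) measurable_snd.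
have blam : bmeas (fun _ : X * X => lambda) by exact: bmeas_cst.
rewrite -[leRHS]/(lambda%:E) -[in leRHS](bint_cst (D \x D)%E lambda).
rewrite (bint_EFin _ blam); apply: ge0_le_integral => //.
- by apply/measurable_EFinP; exact: measurable_truncated.
- move=> p _; rewrite lee_fin; case: (leP `|_ - _| lambda) => h.
    by rewrite mul1r.
  by rewrite mul0r ltW.
Qed.
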